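(* Let $f$ be a positive integer, $q=3^f$, and let $e<f$ be an integer such that $4\cdot 3^{e-1}+e\ge 2f+2$. Then \[ \frac{1}{q^2}\sum_{k=0}^{q-1}\binom{2k}{k}\equiv -\beta\binom{2q}{q}\pmod{3^{f-2e+2}}, \] where $\beta$ is the $3$-adic integer \[ \beta=\sum_{k=2}^{\infty}\frac{3^{k-1}}{k}\binom{2k}{k}^{-1}H_{k-1}=1+3+2\cdot 3^3+2\cdot 3^4+2\cdot 3^5+3^7+2\cdot 3^{11}+\cdots. \]
   Context: $H_{k-1}=\sum_{0<i<k}1/i$ denotes the harmonic number. The series defining $\beta$ converges in $\mathbb{Z}_3$. A congruence $x\equiv y\pmod{3^m}$ between elements of $\mathbb{Q}_3$ means $x-y\in 3^m\mathbb{Z}_3$. *)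

(* Defs.v *)
From HB Require Import structures.
From mathcomp Require Import all_boot all_order all_algebra fraction.
From mathcomp Require Import boolp classical_sets filter.
From mathcomp Require Import topology.

Set Implicit Arguments.
Unset Strict Implicit.
Unset Printing Implicit Defensive.

Import Order.TTheory GRing.Theory Num.Theory.

Local Open Scope classical_set_scope.
Local Open Scope ring_scope.

(** [Z3] is the inverse limit of the rings Z/3^n. The component [x n] is the
    canonical representative, in [0, 3^n), of [x] modulo 3^n: the coherence
    condition forces it into that range. *)

Record Z3 := MkZ3 {
  res :> nat -> int;
  _ : `[< forall n, res n = (res n.+1 %% 3 ^+ n)%Z >] }.

HB.instance Definition _ := [isSub for res].
HB.instance Definition _ := [Choice of Z3 by <:].

Lemma res_coherent (x : Z3) n : x n = (x n.+1 %% 3 ^+ n)%Z.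
Proof. by case: x => u /= /asboolP. Qed.

Lemma res_mod (x : Z3) n : (x n %% 3 ^+ n)%Z = x n.
Proof. by rewrite [in RHS]res_coherent [in LHS]res_coherent modz_mod. Qed.

Lemma Z3P (x y : Z3) : (forall n, x n = y n) -> x = y.
Proof. by move=> xy; apply: val_inj; apply: funext. Qed.

Definition coherent (u : nat -> int) :=
  forall n, (u n.+1 == u n %[mod 3 ^+ n])%Z.

Lemma modz_expS (m : int) n :
  ((m %% 3 ^+ n.+1)%Z %% 3 ^+ n)%Z = (m %% 3 ^+ n)%Z.
Proof.
apply/eqP; rewrite eqz_mod_dvd {2}(divz_eq m (3 ^+ n.+1)).
by rewrite opprD addrCA subrr addr0 rpredN exprS mulrA dvdz_mull.
Qed.

Lemma res_coh (x : Z3) : coherent x.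
Proof. by move=> n; rewrite [in X in _ == X]res_coherent modz_mod. Qed.

Lemma ofseq_subproof u : coherent u ->
  `[< forall n, (u n %% 3 ^+ n)%Z = ((u n.+1 %% 3 ^+ n.+1)%Z %% 3 ^+ n)%Z >].
Proof. by move=> cu; apply/asboolP => n; rewrite modz_expS (eqP (cu n)). Qed.

Definition ofseq u (cu : coherent u) : Z3 := MkZ3 (ofseq_subproof cu).

Lemma const_coh c : coherent (fun=> c).
Proof. by move=> n. Qed.

Lemma add_coh (x y : Z3) : coherent (fun n => x n + y n).
Proof.
by move=> n; rewrite -modzDm (eqP (res_coh x n)) (eqP (res_coh y n)) modzDm.
Qed.

Lemma mul_coh (x y : Z3) : coherent (fun n => x n * y n).
Proof.
by move=> n; rewrite -modzMm (eqP (res_coh x n)) (eqP (res_coh y n)) modzMm.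
Qed.

Lemma opp_coh (x : Z3) : coherent (fun n => - x n).
Proof.
by move=> n; rewrite -modzNm (eqP (res_coh x n)) modzNm.
Qed.

Definition Z3const (c : int) : Z3 := ofseq (const_coh c).
Definition Z3add (x y : Z3) : Z3 := ofseq (@add_coh x y).
Definition Z3mul (x y : Z3) : Z3 := ofseq (@mul_coh x y).
Definition Z3opp (x : Z3) : Z3 := ofseq (@opp_coh x).

Lemma Z3addA : associative Z3add.
Proof. by move=> x y z; apply: Z3P => n /=; rewrite modzDml modzDmr addrA. Qed.

Lemma Z3addC : commutative Z3add.
Proof. by move=> x y; apply: Z3P => n /=; rewrite addrC. Qed.

Lemma Z3add0 : left_id (Z3const 0) Z3add.
Proof. by move=> x; apply: Z3P => n /=; rewrite mod0z add0r res_mod. Qed.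

Lemma Z3addN : left_inverse (Z3const 0) Z3opp Z3add.
Proof. by move=> x; apply: Z3P => n /=; rewrite modzDml addNr. Qed.

HB.instance Definition _ := GRing.isZmodule.Build Z3
  Z3addA Z3addC Z3add0 Z3addN.

Lemma Z3mulA : associative Z3mul.
Proof. by move=> x y z; apply: Z3P => n /=; rewrite modzMml modzMmr mulrA. Qed.

Lemma Z3mulC : commutative Z3mul.
Proof. by move=> x y; apply: Z3P => n /=; rewrite mulrC. Qed.

Lemma Z3mul1 : left_id (Z3const 1) Z3mul.
Proof. by move=> x; apply: Z3P => n /=; rewrite modzMml mul1r res_mod. Qed.

Lemma Z3mulDl : left_distributive Z3mul Z3add.
Proof.
by move=> x y z; apply: Z3P => n /=; rewrite modzMml mulrDl modzDmr modzDml.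
Qed.

Lemma Z3one_neq0 : Z3const 1 != 0.
Proof. by apply/eqP => /(congr1 (fun x : Z3 => x 1%N)). Qed.

HB.instance Definition _ := GRing.Zmodule_isComNzRing.Build Z3
  Z3mulA Z3mulC Z3mul1 Z3mulDl Z3one_neq0.

Lemma res_natr (n k : nat) : (n%:R : Z3) k = (n%:Z %% 3 ^+ k)%Z.
Proof.
elim: n => [|n IH] //; rewrite mulrS.
rewrite -[LHS]/(((1 %% 3 ^+ k)%Z + (n%:R : Z3) k) %% 3 ^+ k)%Z IH.
by rewrite modzDm intS.
Qed.

Lemma resD (x : Z3) m n : (x (n + m)%N %% 3 ^+ n)%Z = x n.
Proof.
elim: m => [|m IH]; first by rewrite addn0 res_mod.
rewrite -[RHS]IH addnS [in RHS]res_coherent exprD.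
apply/eqP; rewrite eqz_mod_dvd.
rewrite {1}(divz_eq (x (n + m).+1) (3 ^+ n * 3 ^+ m)) addrK.
by rewrite mulrCA dvdz_mulr.
Qed.

Lemma Z3_idomain (x y : Z3) : x * y = 0 -> (x == 0) || (y == 0).
Proof.
move=> xy0; apply: contraT; rewrite negb_or => /andP[/eqP x0 /eqP y0].
have ex (z : Z3) : z <> 0 -> exists n, z n != 0.
  move=> z0; apply: contrapT => /forallNP h; apply: z0; apply: Z3P => n.
  by have /negP/negPn/eqP -> := h n; rewrite /= mod0z.
have [a xa] := ex _ x0; have [b yb] := ex _ y0.
have := congr1 (fun z : Z3 => z (a + b)%N) xy0 => /=; rewrite mod0z.
have {}xa : ~~ (3 ^+ a %| x (a + b)%N)%Z.
  by apply: contra xa => /dvdz_mod0P; rewrite resD => ->.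
have {}yb : ~~ (3 ^+ b %| y (a + b)%N)%Z.
  by apply: contra yb => /dvdz_mod0P; rewrite addnC resD => ->.
have pf c (m : int) : (3 ^+ c %| m)%Z = (3 ^ c %| `|m|)%N.
  by rewrite dvdzE abszX.
move=> /dvdz_mod0P; move: xa yb; rewrite !pf abszM.
move: `|x _|%N `|y _|%N => s t.
have [->|s0] := posnP s; first by rewrite dvdn0.
have [->|t0] := posnP t; first by rewrite dvdn0.
rewrite !pfactor_dvdn ?muln_gt0 ?s0// lognM// -!ltnNge => h1 h2 h3.
by have := leq_trans (leq_add h1 h2) (leqW h3); rewrite addSn addnS ltnn.
Qed.

Definition Z3unit : pred Z3 := fun x => `[< exists y : Z3, y * x = 1 >].
Definition Z3inv (x : Z3) : Z3 := xget x [set y : Z3 | y * x = 1].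

Lemma Z3mulV : {in Z3unit, left_inverse 1 Z3inv *%R}.
Proof.
by move=> x /asboolP; apply: (@xgetPex _ x [set y : Z3 | y * x = 1]).
Qed.

Lemma Z3unitP (x y : Z3) : y * x = 1 -> Z3unit x.
Proof. by move=> yx; apply/asboolP; exists y. Qed.

Lemma Z3inv_out : {in [predC Z3unit], Z3inv =1 id}.
Proof.
move=> x /negP xu; apply: xgetPN => y yx; apply: xu.
by apply/asboolP; exists y.
Qed.

HB.instance Definition _ := GRing.ComNzRing_hasMulInverse.Build Z3
  Z3mulV Z3unitP Z3inv_out.

HB.instance Definition _ := GRing.ComUnitRing_isIntegral.Build Z3 Z3_idomain.

Definition Q3 := {fraction Z3}.
HB.instance Definition _ := GRing.Field.on Q3.

(** The exponent is an integer because moduli [3 ^ m] with [m < 0] are allowed. *)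
Definition congr3 (m : int) (x y : Q3) : Prop :=
  exists z : Z3, x - y = 3 ^ m * (tofrac z : Q3).

Definition Q3nbhs (x : Q3) : set_system Q3 :=
  filter_from [set: nat] (fun m : nat => [set y : Q3 | congr3 m y x]).

HB.instance Definition _ := isPointed.Build Q3 0.
HB.instance Definition _ := hasNbhs.Build Q3 Q3nbhs.

Lemma congr3_refl m x : congr3 m x x.
Proof. by exists 0; rewrite subrr tofrac0 mulr0. Qed.

Lemma congr3_trans m y x z : congr3 m x y -> congr3 m y z -> congr3 m x z.
Proof.
move=> [u xy] [v yz]; exists (u + v).
by rewrite tofracD mulrDr -xy -yz addrA subrK.
Qed.

Lemma congr3_le (m n : nat) x y : (m <= n)%N -> congr3 n x y -> congr3 m x y.
Proof.
move=> mn [u xy]; exists (3 ^+ (n - m) * u).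
rewrite xy tofracM tofracXn.
have -> : tofrac 3 = 3 :> Q3 by exact: (rmorph_nat (@FracField.tofrac Z3) 3).
by rewrite mulrA -!exprnP -exprD subnKC.
Qed.

Lemma Q3nbhs_filter (x : Q3) : ProperFilter (nbhs x).
Proof.
split; last first.
  apply: filter_from_filter; first by exists 0%N.
  move=> m n _ _; exists (maxn m n) => // y h; split.
    exact: congr3_le (leq_maxl m n) h.
  exact: congr3_le (leq_maxr m n) h.
by move=> [m _] /(_ x (congr3_refl _ _)).
Qed.

Lemma Q3nbhs_singleton (x : Q3) (A : set Q3) : nbhs x A -> A x.
Proof. by move=> [m _]; apply; exact: congr3_refl. Qed.

Lemma Q3nbhs_nbhs (x : Q3) (A : set Q3) : nbhs x A -> nbhs x (nbhs^~ A).
Proof.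
move=> [m _ mA]; exists m => // y yx; exists m => // z zy.
exact/mA/(congr3_trans zy yx).
Qed.

HB.instance Definition _ := Nbhs_isNbhsTopological.Build Q3
  Q3nbhs_filter Q3nbhs_singleton Q3nbhs_nbhs.

Lemma Q3_hausdorff : hausdorff_space Q3.
Proof.
move=> p q pq; apply/eqP; rewrite -subr_eq0; apply/eqP.
have h (m : nat) : congr3 m p q.
  have [|| r [[u rp] rq]] := pq [set y | congr3 m y p] [set y | congr3 m y q].
  - by exists m.
  - by exists m.
  apply: congr3_trans rq; exists (- u).
  by rewrite tofracN mulrN -rp opprB.
have [z pqz] := h 0%N; rewrite pqz expr0z mul1r.
suff -> : z = 0 by rewrite tofrac0.
apply: Z3P => m; have [w] := h m; rewrite pqz expr0z mul1r.
have -> : (3 : Q3) ^ m * tofrac w = tofrac (3 ^+ m * w).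
  by rewrite tofracM tofracXn; congr (_ ^+ _ * _); exact/esym/rmorph_nat.
move=> /eqP; rewrite tofrac_eq => /eqP ->.
have -> : (0 : Z3) m = 0 by rewrite /= mod0z.
rewrite -natrX -[LHS]/((_ * _) %% _)%Z res_natr -natz natrX modzMml.
by rewrite modzMr.
Qed.

Lemma Q3_natr_eq0 (n : nat) : (n%:R == 0 :> Q3) = (n == 0%N).
Proof.
have -> : n%:R = tofrac n%:R :> Q3.
  exact/esym/(rmorph_nat (@FracField.tofrac Z3)).
rewrite tofrac_eq0; apply/eqP/eqP => [n0|->//].
have := congr1 (fun x : Z3 => x n) n0; rewrite res_natr.
have -> : (0 : Z3) n = 0 by rewrite /= mod0z.
have -> : 3 ^+ n = (3 ^ n)%N%:Z :> int by rewrite -[RHS]natz natrX.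
by rewrite modz_nat (modn_small (ltn_expl n (isT : (1 < 3)%N))) => -[].
Qed.

Definition harmonic_num (n : nat) : Q3 := \sum_(1 <= i < n.+1) i%:R^-1.

Definition beta_term (k : nat) : Q3 :=
  3 ^+ k.-1 / k%:R * ('C(k.*2, k)%:R)^-1 * harmonic_num k.-1.

Definition beta_partial (n : nat) : Q3 := \sum_(2 <= k < n) beta_term k.

(** The limit is unique by [Q3_hausdorff], but [limn] only means something once
    [cvgn beta_partial] is known. *)
Definition beta : Q3 := limn beta_partial.

(* Main.v *)
Require Import Defs.
From Stdlib Require Import ZArith.
From mathcomp Require Import all_boot all_order all_algebra.
From mathcomp Require Import boolp classical_sets filter topology.
From mathcomp Require Import ring lra ssrZ zify.

Import Order.TTheory GRing.Theory Num.Theory.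
Local Open Scope classical_set_scope.
Local Open Scope ring_scope.

(** For every [n], writing [w k = 3^k / ((k + 1) C(2k+2, k+1))],
      sum_(k < n) C(2k, k) = n C(2n, n) sum_(k < n) w k prod_(0 < i <= k) (1 - n/i).
    Taking [n = q = 3^f] and expanding each product to first order in [q] gives
    [sum w k - q sum w k H_k + O(q^2)], where [sum w k H_k] tends to beta.  It
    remains to see that [sum_(k >= 0) w k = 0] in Q_3.  As [2 w k] is the integral
    of [3^k X^k (1 - X)^k] over [0, 1], this sum is half the integral of
    [1 / (1 - 3X + 3X^2)], a combination of the logarithms of [1 - u] and [1 - v]
    with [u, v] the roots of [X^2 - 3X + 3]; these are cube roots of unity, whose
    3-adic logarithms are zero.  Concretely, [(1 - u)^Q = 1] for [Q = 3^F] is an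
    exact identity between binomial sums which is 3-adically close to the
    integral. *)

(** * Binomial identities *)

Lemma central_binS (m : nat) :
  (m.+1 * 'C(m.+1.*2, m.+1) = 2 * m.*2.+1 * 'C(m.*2, m))%N.
Proof.
have h1 := mul_bin_diag m.+1.*2 m; have h2 := mul_bin_diag m.*2.+1 m.
have h3 : 'C(m.*2.+1, m.+1) = 'C(m.*2.+1, m).
  by rewrite -(@bin_sub _ m); [congr 'C(_, _); lia | lia].
apply/eqP; rewrite -(eqn_pmul2l (ltn0Sn m)); apply/eqP.
have e : m.+1.*2.-1 = m.*2.+1 by [].
rewrite /= h3 in h2; rewrite -h1 e -[in RHS]mulnA h2 -muln2; lia.
Qed.

(* Indexed so that [beta_term k.+1 = invcb k * harmonic_num k]. *)
Definition invcb (F : fieldType) (k : nat) : F :=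
  3 ^+ k / (k.+1%:R * 'C(k.+1.*2, k.+1)%:R).
Arguments invcb {F}.

Lemma invcbS (F : fieldType) (F0 : [pchar F] =i pred0) (k : nat) :
  invcb k.+1 = invcb k * (3 * k.+1%:R / (2 * k.*2.+3%:R)) :> F.
Proof.
have nz n : n.+1%:R != 0 :> F by rewrite (pcharf0P F).1.
have cnz : 'C(k.+1.*2, k.+1)%:R != 0 :> F.
  by rewrite (pcharf0P F).1// -lt0n bin_gt0; lia.
rewrite /invcb -!natrM central_binS !natrM exprS doubleS.
by field; rewrite -natrD nat1r !nz ?(nz 1) cnz.
Qed.

(** The factors are [-(n + 1 - i) / i], so a falling factorial over [k!] appears. Its vanishing for
    [k > n] later cuts sums off at [n]. *)
Lemma prod_one_sub_div (F : fieldType) (F0 : [pchar F] =i pred0) (n k : nat) :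
  \prod_(1 <= i < k.+1) (1 - n.+1%:R / i%:R) = (-1) ^+ k * 'C(n, k)%:R :> F.
Proof.
have nz m : m.+1%:R != 0 :> F by rewrite (pcharf0P F).1.
elim: k => [|k IH]; first by rewrite big_geq// bin0 mulr1.
rewrite big_nat_recr//= IH exprSr -!mulrA; congr (_ * _).
have [kn|nk] := leqP k n; last by rewrite !bin_small ?mul0r ?mulr0//; lia.
have := congr1 (fun x => x%:R : F) (mul_bin_left n k).
rewrite !natrM natrB// => h; rewrite -['C(n, k.+1)%:R](mulKf (nz k)) h.
by field; rewrite nat1r nz.
Qed.

(** With [S n] the alternating sum, this is [2 (2n + 3) S (n + 1) = (n + 1) S n + 1]; multiplied by
    C(2n+2, n+1) it becomes the induction step of [sum_central_bin]. *)
Lemma sum_bin_invcb (F : fieldType) (F0 : [pchar F] =i pred0) (n : nat) :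
  2 * n.*2.+3%:R * \sum_(0 <= k < n.+2) (-1) ^+ k * 'C(n.+1, k)%:R * invcb k =
  n.+1%:R * (\sum_(0 <= k < n.+1) (-1) ^+ k * 'C(n, k)%:R * invcb k) + 1 :> F.
Proof.
have nz m : m.+1%:R != 0 :> F by rewrite (pcharf0P F).1.
(* Gosper-Zeilberger certificate of the recurrence *)
pose G k : F := - 2 * k.*2.+1%:R * ((-1) ^+ k * invcb k * 'C(n.+1, k)%:R).
have -> : \sum_(0 <= k < n.+1) (-1) ^+ k * 'C(n, k)%:R * invcb k =
    \sum_(0 <= k < n.+2) (-1) ^+ k * 'C(n, k)%:R * invcb k :> F.
  by rewrite [RHS]big_nat_recr//= (bin_small (ltnSn n)) mulr0 mul0r addr0.
apply/eqP; rewrite addrC -subr_eq !big_distrr -sumrB /=; apply/eqP.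
under eq_big_nat => k /andP[_ kn].
  have -> : 2 * n.*2.+3%:R * ((-1) ^+ k * 'C(n.+1, k)%:R * invcb k) -
      n.+1%:R * ((-1) ^+ k * 'C(n, k)%:R * invcb k) = G k.+1 - G k.
    have h1 := congr1 (fun x => x%:R : F) (mul_bin_left n.+1 k).
    have h2 := congr1 (fun x => x%:R : F) (mul_bin_down n.+1 k).
    rewrite !natrM natrB// in h1 h2.
    rewrite /G invcbS// exprS doubleS.
    have -> : - 2 * k.*2.+3%:R * (-1 * (-1) ^+ k *
       (invcb k * (3 * k.+1%:R / (2 * k.*2.+3%:R))) * 'C(n.+1, k.+1)%:R) =
       3 * ((-1) ^+ k * invcb k) * (k.+1%:R * 'C(n.+1, k.+1)%:R) :> F.
      by field; rewrite -?natrD ?nat1r ?nz ?(nz 1).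
    rewrite h1 -!muln2.
    have -> : n.+1%:R * ((-1) ^+ k * 'C(n, k)%:R * invcb k) =
       ((-1) ^+ k * invcb k) * (n.+1%:R * 'C(n, k)%:R) :> F by ring.
    rewrite h2 -(addn1 (k * 2)) -(addn3 (n * 2)) -addn1 !natrD !natrM; ring.
  over.
(* The upper end vanishes with C(n+1, n+2); [- G 0 = 2 * invcb 0 = 1] is the added constant. *)
rewrite telescope_sumr// /G bin_small// bin0 expr0 /invcb.
have c1 : 'C(1.*2, 1) = 2%N by [].
by rewrite c1 double0 expr0 !mulr0; field; rewrite (nz 1).
Qed.

Lemma sum_central_bin (F : fieldType) (F0 : [pchar F] =i pred0) (n : nat) :
  \sum_(0 <= k < n) 'C(k.*2, k)%:R =
  n%:R * 'C(n.*2, n)%:R *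
    \sum_(0 <= k < n) invcb k * \prod_(1 <= i < k.+1) (1 - n%:R / i%:R) :> F.
Proof.
have nz m : m.+1%:R != 0 :> F by rewrite (pcharf0P F).1.
case: n => [|n]; first by rewrite !big_geq// mulr0.
under [in RHS]eq_bigr do rewrite prod_one_sub_div// mulrC.
elim: n => [|n IH].
  rewrite !big_nat1 bin0 expr0 /invcb !mul1r.
  have c1 : 'C(1.*2, 1) = 2%N by [].
  by rewrite c1; field; rewrite (nz 1).
rewrite big_nat_recr//= IH -[in RHS](natrM _ n.+2) central_binS !natrM doubleS.
transitivity ('C(n.+1.*2, n.+1)%:R * (n.+1%:R *
  (\sum_(0 <= k < n.+1) (-1) ^+ k * 'C(n, k)%:R * invcb k) + 1) : F).
  by ring.
by rewrite -sum_bin_invcb// doubleS; ring.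
Qed.

(* Termwise integration of [X^a (1 - X)^m] over [0, 1]. *)
Lemma sum_coef_beta (F : fieldType) (F0 : [pchar F] =i pred0) (m a N : nat) :
  (a + m < N)%N ->
  \sum_(0 <= j < N) ('X^a * (1 - 'X) ^+ m : {poly F})`_j / j.+1%:R =
  (a`! * m`!)%:R / (a + m).+1`!%:R.
Proof.
have fnz i : i`!%:R != 0 :> F by rewrite (pcharf0P F).1// -lt0n fact_gt0.
have nz i : i.+1%:R != 0 :> F by rewrite (pcharf0P F).1.
elim: m a => [|m IH] a aN.
  rewrite addn0 in aN *; rewrite expr0 mulr1 big_mkord.
  rewrite (bigD1 (Ordinal aN))//= coefXn eqxx big1 => [|i].
    rewrite mulr1n factS fact0 muln1 addr0 natrM; field.
    by rewrite fnz -?natrD ?nat1r nz.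
  by rewrite -val_eqE /= coefXn => /negPf ->; rewrite mul0r.
rewrite (eq_bigr (fun j => ('X^a * (1 - 'X) ^+ m : {poly F})`_j / j.+1%:R
    - ('X^(a.+1) * (1 - 'X) ^+ m : {poly F})`_j / j.+1%:R)); last first.
  move=> j _; rewrite -mulrBl -coefB; congr ((polyseq _)`_j / _).
  by rewrite !exprS; ring.
rewrite sumrB !IH ?addSn ?addnS//; try lia.
rewrite [(a + m).+2`!]factS ![_.+1`!]factS !natrM.
by field; rewrite ?fnz -?natrD ?nat1r ?nz.
Qed.

Lemma sum_coef_invcb (F : fieldType) (F0 : [pchar F] =i pred0) (k N : nat) :
  (k.*2 < N)%N ->
  \sum_(0 <= j < N) (3 ^+ k *: ('X^k * (1 - 'X) ^+ k) : {poly F})`_j / j.+1%:R =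
  2 * invcb k.
Proof.
move=> kN; have fnz i : i`!%:R != 0 :> F.
  by rewrite (pcharf0P F).1// -lt0n fact_gt0.
have nz i : i.+1%:R != 0 :> F by rewrite (pcharf0P F).1.
under eq_bigr do rewrite coefZ -mulrA.
rewrite -mulr_sumr sum_coef_beta ?addnn// /invcb.
have h : (k.+1 * 'C(k.+1.*2, k.+1) * (k`! * k`!) = 2 * k.*2.+1`!)%N.
  have := @bin_fact k.+1.*2 k.+1; rewrite -addnn leq_addr addnK => /(_ isT).
  rewrite addnn doubleS ![_.+1`!]factS -!muln2 => h.
  by apply/eqP; rewrite -(eqn_pmul2l (ltn0Sn k)); apply/eqP; nia.
have cnz : 'C(k.+1.*2, k.+1)%:R != 0 :> F.
  by rewrite (pcharf0P F).1// -lt0n bin_gt0; lia.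
move: h (fnz k.*2.+1); move: (k.*2.+1)`! => N1 /(congr1 (fun x => x%:R : F)).
rewrite !natrM => h N1nz.
transitivity (3 ^+ k * (k.+1%:R * 'C(k.+1.*2, k.+1)%:R * (k`!%:R * k`!%:R)) /
  (N1%:R * (k.+1%:R * 'C(k.+1.*2, k.+1)%:R)) : F).
  by field; rewrite -?natrD ?nat1r nz cnz N1nz.
by rewrite h; field; rewrite ?nat1r nz cnz N1nz.
Qed.

(** * The series 1 / (1 - 3X + 3X^2) and its Lucas coefficients *)

(** Truncated by powers of 3X(1 - X) rather than of X, so that the integral over [0, 1] is exactly
    twice a partial sum of [invcb]. *)
Definition geomX (F : fieldType) (N : nat) : {poly F} :=
  \sum_(0 <= k < N) 3 ^+ k *: ('X^k * (1 - 'X) ^+ k).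
Arguments geomX {F}.

Lemma sum_coef_geomX (F : fieldType) (F0 : [pchar F] =i pred0) (N M : nat) :
  (N.*2 <= M)%N ->
  \sum_(0 <= j < M) (geomX N : {poly F})`_j / j.+1%:R =
  2 * \sum_(0 <= k < N) invcb k.
Proof.
move=> NM; rewrite mulr_sumr.
rewrite (eq_bigr (fun j => \sum_(0 <= k < N)
  (3 ^+ k *: ('X^k * (1 - 'X) ^+ k) : {poly F})`_j / j.+1%:R)); last first.
  by move=> j _; rewrite coef_sum mulr_suml.
rewrite exchange_big /=; apply: eq_big_nat => k kN.
by rewrite sum_coef_invcb//; lia.
Qed.

(** The Lucas sequence (u^n - v^n) / (u - v) for the roots u, v of X^2 - 3X + 3. *)
Fixpoint lucas3 (R : nzRingType) (n : nat) : R :=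
  match n with
  | 0 => 0
  | 1 => 1
  | (m.+1 as n').+1 => 3 * lucas3 R n' - 3 * lucas3 R m
  end.

(** Multiplication by 1 - 3X + 3X^2 leaves 1 - (3X(1 - X))^N, whose error starts in degree N; below
    it the coefficients obey the recurrence of [lucas3]. *)
Lemma coef_geomX (F : fieldType) (N j : nat) :
  (j < N)%N -> (geomX N : {poly F})`_j = lucas3 F j.+1.
Proof.
have e : (geomX N : {poly F}) * (1 - 3%:P * 'X + 3%:P * 'X^2) =
    1 - (3 ^+ N)%:P * (1 - 'X) ^+ N * 'X^N.
  pose y : {poly F} := 3%:P * ('X * (1 - 'X)).
  have -> : 1 - 3%:P * 'X + 3%:P * 'X^2 = 1 - y by rewrite /y; ring.
  have -> : geomX N = \sum_(i < N) y ^+ i.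
    rewrite /geomX big_mkord; apply: eq_bigr => i _.
    by rewrite /y !exprMn -mul_polyC polyC_exp.
  rewrite mulrC -[RHS]opprK opprB -[1 - y]opprB mulNr -subrX1 /y.
  by rewrite !exprMn polyC_exp; ring.
have rec i : (i.+2 < N)%N ->
    (geomX N : {poly F})`_i.+2 = 3 * (geomX N)`_i.+1 - 3 * (geomX N)`_i.
  move=> iN; have := congr1 (fun p : {poly F} => p`_i.+2) e.
  rewrite mulrDr mulrBr mulr1 mulrCA [in X in _ + X]mulrCA !(coefB, coefD).
  rewrite !mulrA !coefMXn !coefMX !coefCM iN coef1 /= subr0 => h.
  by apply/eqP; rewrite -subr_eq0; apply/eqP; rewrite -[RHS]h; ring.
have h0 : (0 < N)%N -> (geomX N : {poly F})`_0 = 1.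
  move=> N0; have := congr1 (fun p : {poly F} => p`_0) e.
  rewrite mulrDr mulrBr mulr1 mulrCA [in X in _ + X]mulrCA !(coefB, coefD).
  by rewrite !mulrA !coefMXn !coefMX N0 coef1 /= !subr0 addr0.
have h1 : (1 < N)%N -> (geomX N : {poly F})`_1 = 3.
  move=> N1; have := congr1 (fun p : {poly F} => p`_1) e.
  rewrite mulrDr mulrBr mulr1 mulrCA [in X in _ + X]mulrCA !(coefB, coefD).
  rewrite !mulrA !coefMXn !coefMX !coefCM N1 coef1 /= subr0 addr0.
  by rewrite h0 ?(ltnW N1)// mulr1 => /eqP; rewrite subr_eq0 => /eqP.
suff : ((j < N)%N -> (geomX N : {poly F})`_j = lucas3 F j.+1) /\
       ((j.+1 < N)%N -> (geomX N : {poly F})`_j.+1 = lucas3 F j.+2) by case.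
elim: j => [|j [IH1 IH2]]; split => // jN.
- by rewrite h1//= mulr1 mulr0 subr0.
- by rewrite rec// IH1 ?IH2//; lia.
Qed.

(** For the shift E, the left side is (1 - E)^(n+1) b at 0; Pascal's rule moves one factor 1 - E
    onto b. *)
Lemma sum_binS_alt (R : nzRingType) (b : nat -> R) (n : nat) :
  \sum_(0 <= j < n.+2) (-1) ^+ j * 'C(n.+1, j)%:R * b j =
  \sum_(0 <= j < n.+1) (-1) ^+ j * 'C(n, j)%:R * (b j - b j.+1).
Proof.
under [RHS]eq_bigr do rewrite mulrBr.
rewrite sumrB [in RHS]big_nat_recl//= big_nat_recl//= !bin0 -addrA; congr (_ + _).
under eq_bigr do rewrite binS natrD mulrDr mulrDl.
rewrite big_split /= [X in X + _]big_nat_recr//= bin_small// mulr0 mul0r addr0.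
congr (_ + _); rewrite -sumrN; apply: eq_bigr => j _.
by rewrite exprS mulN1r !mulNr.
Qed.

(* [lucas3] is annihilated by [E^2 - 3 E + 3] for the shift [E], which divides
   [(1 - E)^3 - 1]. *)
Lemma sum_bin_lucas3 (R : comNzRingType) (m : nat) :
  \sum_(0 <= j < (3 * m).+1) (-1) ^+ j * 'C(3 * m, j)%:R * lucas3 R j = 0.
Proof.
elim: m => [|m IH]; first by rewrite muln0 big_nat1 mulr0.
rewrite mulnS !addSn add0n !sum_binS_alt -[RHS]IH; apply: eq_bigr => j _.
by congr (_ * _); rewrite /=; ring.
Qed.

(** The product is (-1)^j C(3m-1, j), and C(3m-1, j) / (j+1) = C(3m, j+1) / (3m), so the sum is a
    multiple of the one in [sum_bin_lucas3]. When 3m is a power of 3 the products are 3-adically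
    close to 1, and the sum approximates the integral of [geomX]. *)
Lemma sum_geomX_prod (F : fieldType) (F0 : [pchar F] =i pred0) (m M : nat) :
  (0 < m)%N -> ((3 * m) <= M)%N ->
  \sum_(0 <= j < M) (geomX (3 * m) : {poly F})`_j / j.+1%:R *
    \prod_(1 <= i < j.+1) (1 - (3 * m)%:R / i%:R) = 0.
Proof.
move=> m0 mM; have nz i : i.+1%:R != 0 :> F by rewrite (pcharf0P F).1.
have S0 : \sum_(0 <= j < 3 * m)
    (-1) ^+ j.+1 * 'C(3 * m, j.+1)%:R * lucas3 F j.+1 = 0.
  by rewrite -[RHS](sum_bin_lucas3 F m) big_nat_recl//= mulr0 add0r.
have : (0 < 3 * m)%N by lia.
move: mM S0; case: (3 * m)%N => // n nM + _.
have := @coef_geomX F n.+1; move: (lucas3 F) => b coefG S0.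
apply: (mulfI (nz n)).
rewrite mulr0 -[RHS]oppr0 -[X in _ = - X]S0 mulr_sumr -sumrN.
rewrite (big_cat_nat _ nM)//= [X in _ + X]big1_seq ?addr0; last first.
  move=> j /andP[_]; rewrite mem_index_iota => /andP[jn _].
  by rewrite prod_one_sub_div// bin_small ?mulr0//; lia.
apply: eq_big_nat => j /andP[_ jn]; rewrite coefG// prod_one_sub_div// exprS.
have := congr1 (fun x => x%:R : F) (mul_bin_diag n.+1 j).
rewrite !natrM => h.
transitivity ((-1) ^+ j * b j.+1 / j.+1%:R * (n.+1%:R * 'C(n, j)%:R)).
  by field; rewrite nat1r nz.
by rewrite h; field; rewrite nat1r nz.
Qed.

(** * 3-adic numbers *)

Lemma res_exp3M (m : nat) (w : Z3) (k : nat) :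
  (3 ^+ m * w) k = (3 ^+ m * w k %% 3 ^+ k)%Z.
Proof.
by rewrite -natrX -[LHS]/((_ * _) %% _)%Z res_natr modzMml -natz natrX.
Qed.

Lemma res_eqP (x y : Z3) (m : nat) :
  x m = y m <-> exists w : Z3, x - y = 3 ^+ m * w.
Proof.
have xyE k : (x - y) k = ((x k - y k) %% 3 ^+ k)%Z.
  by rewrite -[LHS]/((x k + (- y k %% 3 ^+ k)%Z) %% 3 ^+ k)%Z modzDmr.
split=> [xy|[w /(congr1 (fun z : Z3 => z m))]]; last first.
  rewrite xyE res_exp3M modzMr => /dvdz_mod0P h.
  by rewrite -(res_mod x) -(res_mod y); apply/eqP; rewrite eqz_mod_dvd.
set z := x - y; have dz k : (3 ^+ m %| z (m + k)%N)%Z.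
  apply/dvdz_mod0P; rewrite resD /z xyE xy subrr.
  exact: mod0z.
have nz k : (3 : int) ^+ k != 0 by rewrite expf_neq0.
(* Division by 3^m loses m digits, so component k is read off component m + k. *)
have cu : coherent (fun k => (z (m + k)%N %/ 3 ^+ m)%Z).
  move=> k; rewrite eqz_mod_dvd -(dvdz_mul2r (nz m)) mulrBl.
  rewrite !divzK// mulrC -exprD -eqz_mod_dvd addnS; exact: res_coh.
exists (ofseq cu); apply: Z3P => k; rewrite res_exp3M.
rewrite -[ofseq cu k]/(_ %% _)%Z modzMmr mulrC divzK//.
by rewrite addnC resD.
Qed.

Lemma Z3_complete (z : nat -> Z3) (N : nat -> nat) :
  (forall m n, (N m <= n)%N -> z n m = z (N m) m) ->
  exists b : Z3, forall m n, (N m <= n)%N -> z n m = b m.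
Proof.
move=> zN; have cu : coherent (fun m => z (N m) m).
  (* The index [N m + N m.+1] lies beyond both moduli, so consecutive stable components can be
     compared there. *)
  move=> m; apply/eqP; have := zN m (N m + N m.+1)%N (leq_addr _ _).
  have := zN m.+1 (N m + N m.+1)%N (leq_addl _ _) => <- <-.
  by rewrite -res_coherent res_mod.
exists (ofseq cu) => m n mn.
by rewrite zN// -[RHS]/(_ %% _)%Z res_mod.
Qed.

(** Bezout coefficients invert n modulo each 3^k; they are coherent because such inverses are unique
    modulo 3^k. *)
Lemma Z3_inv_coprime (n : nat) : coprime n 3 -> exists w : Z3, n%:R * w = 1.
Proof.
move=> n3; have n3k k : coprimez n (3 ^+ k).
  have -> : 3 ^+ k = (3 ^ k)%N%:Z :> int by rewrite -[RHS]natz natrX.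
  by rewrite coprimezE /= coprimeXr.
pose u k := (egcdz n (3 ^+ k)).1.
have uP k : exists v, u k * n%:Z + v * 3 ^+ k = 1.
  rewrite /u; case: egcdzP => a b; rewrite (eqP (n3k k)) => h _.
  by exists b.
have cu : coherent u.
  move=> k; have [v h] := uP k; have [v' h'] := uP k.+1.
  rewrite eqz_mod_dvd -(@Gauss_dvdzr _ n); last by rewrite coprimez_sym.
  apply/dvdzP; exists (v - v' * 3); rewrite exprS in h'.
  apply/eqP; rewrite -subr_eq0.
  have -> : n%:Z * (u k.+1 - u k) - (v - v' * 3) * 3 ^+ k =
    (u k.+1 * n%:Z + v' * (3 * 3 ^+ k)) - (u k * n%:Z + v * 3 ^+ k) by ring.
  by rewrite h h' subrr.
exists (ofseq cu); apply: Z3P => k.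
rewrite -[LHS]/((_ * (_ %% _)%Z) %% _)%Z res_natr modzMm.
have [v h] := uP k; apply/eqP; rewrite eqz_mod_dvd; apply/dvdzP.
exists (- v); apply/eqP; rewrite -subr_eq0.
have -> : n%:Z * u k - 1 - - v * 3 ^+ k = u k * n%:Z + v * 3 ^+ k - 1 by ring.
by rewrite h subrr.
Qed.

(** * Lower bounds on 3-adic valuations *)

Lemma Q3_pchar : [pchar Q3] =i pred0.
Proof. by apply/pcharf0P => n; rewrite Q3_natr_eq0. Qed.

Lemma Q3_three_neq0 : (3 : Q3) != 0.
Proof. by rewrite Q3_natr_eq0. Qed.

Lemma tofrac_exp3 (m : nat) : tofrac (3 ^+ m) = 3 ^+ m :> Q3.
Proof. by rewrite tofracXn; congr (_ ^+ _); exact/rmorph_nat. Qed.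

(* [congr3 m x y] is [vge m (x - y)] by conversion. *)
Definition vge (m : int) (x : Q3) : Prop :=
  exists z : Z3, x = 3 ^ m * tofrac z.

Lemma vgeP (m : nat) (x y : Z3) : vge m (tofrac x - tofrac y) <-> x m = y m.
Proof.
rewrite res_eqP; split=> -[w h]; exists w.
  by apply/eqP; rewrite -tofrac_eq tofracB h tofracM tofrac_exp3.
by rewrite -tofracB h tofracM tofrac_exp3.
Qed.

Lemma vge0 m : vge m 0. Proof. by exists 0; rewrite tofrac0 mulr0. Qed.

Lemma vgeD m x y : vge m x -> vge m y -> vge m (x + y).
Proof. by move=> [a ->] [b ->]; exists (a + b); rewrite tofracD mulrDr. Qed.

Lemma vgeN m x : vge m x -> vge m (- x).
Proof. by move=> [a ->]; exists (- a); rewrite tofracN mulrN. Qed.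

Lemma vgeB m x y : vge m x -> vge m y -> vge m (x - y).
Proof. by move=> xm /vgeN; apply: vgeD. Qed.

Lemma vgeM m n x y : vge m x -> vge n y -> vge (m + n) (x * y).
Proof.
move=> [a ->] [b ->]; exists (a * b).
by rewrite tofracM expfzDr ?Q3_three_neq0// mulrACA.
Qed.

Lemma vge_nat n : vge 0 n%:R.
Proof. by exists n%:R; rewrite expr0z mul1r; apply/esym/rmorph_nat. Qed.

Lemma vge_exp3 (m : int) : vge m (3 ^ m).
Proof. by exists 1; rewrite tofrac1 mulr1. Qed.

Lemma vge_le m n x : n <= m -> vge m x -> vge n x.
Proof.
move=> nm [a ->]; have [k ->] : exists k : nat, m = n + k.
  by exists `|m - n|%N; move: nm; lia.
exists (3 ^+ k * a).
by rewrite expfzDr ?Q3_three_neq0// tofracM tofrac_exp3 mulrA.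
Qed.

Lemma vge_sum m (I : Type) (r : seq I) (P : pred I) (t : I -> Q3) :
  (forall i, P i -> vge m (t i)) -> vge m (\sum_(i <- r | P i) t i).
Proof. by move=> h; apply: big_ind => //; [exact: vge0|exact: vgeD]. Qed.

Lemma vge_sum_nat m (a b : nat) (t : nat -> Q3) :
  (forall i, (a <= i < b)%N -> vge m (t i)) -> vge m (\sum_(a <= i < b) t i).
Proof.
move=> h; rewrite big_seq_cond; apply: vge_sum => i.
by rewrite andbT mem_index_iota; apply: h.
Qed.

Lemma vge_inv_coprime n : coprime n 3 -> vge 0 n%:R^-1.
Proof.
move=> n3; have [w nw] := Z3_inv_coprime n n3; exists w.
have nz : n%:R != 0 :> Q3.
  by rewrite Q3_natr_eq0; apply: contraTneq n3 => ->.
apply: (mulfI nz); rewrite divff// expr0z mul1r.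
transitivity (tofrac (n%:R * w)); first by rewrite nw tofrac1.
by rewrite tofracM; congr (_ * _); apply: rmorph_nat.
Qed.

(** The power of 3 dividing n is at most n. This bound, unlike the valuation itself, is monotone in
    n; n = 0 is covered by [0^-1 = 0]. *)
Lemma vge_inv n : vge (- (trunc_log 3 n)%:Z) n%:R^-1.
Proof.
have [->|n0] := posnP n; first by rewrite invr0; exact: vge0.
have [m m3 nE] := pfactor_coprime (isT : prime 3) n0.
rewrite nE natrM natrX invfM mulrC.
apply: (vge_le (- (logn 3 n)%:Z + 0)).
  rewrite -nE addr0 lerN2 lez_nat trunc_log_max// dvdn_leq//.
  exact: pfactor_dvdnn.
apply: vgeM; last by apply: vge_inv_coprime; rewrite coprime_sym.
by rewrite exprnP invr_expz; exact: vge_exp3.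
Qed.

(** By the ultrametric inequality a tail is as small as its terms, which gives both convergence and
    an explicit truncation error. *)
Lemma congr3_series_limit (t : nat -> Q3) :
  (forall k, vge 0 (t k)) ->
  (forall m : nat, exists N, forall k, (N <= k)%N -> vge m (t k)) ->
  exists b : Z3, forall (m N : nat), (forall k, (N <= k)%N -> vge m (t k)) ->
    vge m (tofrac b - \sum_(0 <= k < N) t k).
Proof.
move=> t0 /choice[N NP].
have /choice[z zE] n : exists z : Z3, \sum_(0 <= k < n) t k = tofrac z.
  have [z ->] : vge 0 (\sum_(0 <= k < n) t k) by apply: vge_sum.
  by exists z; rewrite expr0z mul1r.
have tail (m a n : nat) : (forall k, (a <= k)%N -> vge m (t k)) -> (a <= n)%N ->
    z n m = z a m.
  move=> h an; apply/vgeP; rewrite -!zE (big_cat_nat _ an)//= addrAC subrr add0r.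
  by apply: vge_sum_nat => i /andP[ai _]; apply: h.
have [b bP] : exists b : Z3, forall m n, (N m <= n)%N -> z n m = b m.
  by apply: Z3_complete => m n; apply: tail; apply: NP.
exists b => m a ha; rewrite zE; apply/vgeP.
by rewrite -(bP m (a + N m)%N) ?leq_addl//; apply: tail; rewrite ?leq_addr.
Qed.

(** * Estimates *)

Lemma muln3_trunc_log (n : nat) : (3 * trunc_log 3 n <= n)%N.
Proof.
have [->|n0] := posnP n; first by rewrite trunc_log0.
apply: leq_trans (trunc_logP (isT : (1 < 3)%N) n0).
elim: (trunc_log 3 n) => // l IH; rewrite expnS.
have := expn_gt0 3 l; lia.
Qed.

(** With slope 1/4, two logarithms cost at most n/2 + 1, which the gain n/2 of [vge_coef_geomX] can
    absorb. *)
Lemma muln4_trunc_log (n : nat) : (4 * trunc_log 3 n <= n.+2)%N.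
Proof.
have [->|n0] := posnP n; first by rewrite trunc_log0.
apply: leq_trans (_ : (3 ^ trunc_log 3 n).+2 <= _)%N; last first.
  by rewrite !ltnS trunc_logP.
elim: (trunc_log 3 n) => // -[|l] // IH; rewrite expnS.
by rewrite expnS in IH *; have := expn_gt0 3 l; lia.
Qed.

Lemma trunc_log3_doubleS (n : nat) :
  (trunc_log 3 n.*2.+1 <= (trunc_log 3 n).+1)%N.
Proof.
have [->|n0] := posnP n; first by [].
by rewrite -trunc_logMp//; apply: leq_trunc_log; lia.
Qed.

Lemma trunc_log3S (n : nat) : (trunc_log 3 n.+1 <= (trunc_log 3 n).+1)%N.
Proof.
by apply: leq_trans (trunc_log3_doubleS n); apply: leq_trunc_log; lia.
Qed.

Lemma vge_inv_trunc_log (n m : nat) :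
  (m <= n)%N -> vge (- (trunc_log 3 n)%:Z) m%:R^-1.
Proof.
by move=> mn; apply: vge_le (vge_inv m); rewrite lerN2 lez_nat leq_trunc_log.
Qed.

Lemma coef_one_subX_exp (k i : nat) :
  vge 0 ((1 - 'X) ^+ k : {poly Q3})`_i /\
  ((k < i)%N -> ((1 - 'X) ^+ k : {poly Q3})`_i = 0).
Proof.
elim: k i => [|k IH] i.
  rewrite expr0 coef1; split; last by case: i.
  by case: eqP => _; [exact: (vge_nat 1)|exact: vge0].
rewrite exprSr mulrBr mulr1 coefB coefMX; case: eqP => [->|i0].
  by rewrite subr0; split=> //; case: (IH 0%N).
have [v1 z1] := IH i; have [v2 z2] := IH i.-1; split; first exact: vgeB.
by move=> ki; rewrite z1 ?z2 ?subr0//; lia.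
Qed.

(** The factor 3^k gives k; the support lies in degrees k to 2k, so k is at least j/2 there, a bound
    independent of k. *)
Lemma vge_coef_beta (k j : nat) :
  vge (maxn k (uphalf j)) (3 ^+ k *: ('X^k * (1 - 'X) ^+ k) : {poly Q3})`_j.
Proof.
rewrite coefZ coefXnM; case: ltnP => [_|kj]; first by rewrite mulr0; exact: vge0.
have [v z] := coef_one_subX_exp k (j - k).
have [jk|jk] := ltnP k (j - k); first by rewrite z// mulr0; exact: vge0.
apply: (vge_le (k%:Z + 0)); last exact: vgeM (vge_exp3 k) v.
by rewrite addr0 lez_nat geq_max leqnn leq_uphalf_double; lia.
Qed.

Lemma vge_coef_geomX (N j : nat) : vge (uphalf j) (geomX N : {poly Q3})`_j.
Proof.
rewrite coef_sum; apply: vge_sum => k _.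
by apply: vge_le (vge_coef_beta k j); rewrite lez_nat leq_maxr.
Qed.

Lemma vge_half m x : vge m (2 * x) -> vge m x.
Proof.
move=> h; have nz : (2 : Q3) != 0 by rewrite Q3_natr_eq0.
by rewrite -(mulKf nz x) -[m]add0r; apply: vgeM => //; exact: vge_inv_coprime.
Qed.

(** In the integral form all coefficients are divisible by 3^k and the denominators are at most 2k +
    1. *)
Lemma vge_invcb (k : nat) : vge (k%:Z - (trunc_log 3 k)%:Z - 1) (invcb k).
Proof.
apply: vge_half; rewrite -(@sum_coef_invcb _ Q3_pchar k k.*2.+1)//.
apply: vge_sum_nat => j /andP[_ jk].
apply: (vge_le (k%:Z + - (trunc_log 3 k.*2.+1)%:Z)).
  by have := trunc_log3_doubleS k; lia.
apply: vgeM; last exact: vge_inv_trunc_log.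
by apply: vge_le (vge_coef_beta k j); rewrite lez_nat leq_maxl.
Qed.

(** First-order expansion with quadratic error. The two bounds go together: the inductive step of
    the second multiplies the first by a new [y]. *)
Lemma vge_prod_one_sub (m : nat) (k : nat) (y : nat -> Q3) :
  (forall i, (1 <= i < k.+1)%N -> vge m (y i)) ->
  vge m (\prod_(1 <= i < k.+1) (1 - y i) - 1) /\
  vge (m + m)%N
    (\prod_(1 <= i < k.+1) (1 - y i) - 1 + \sum_(1 <= i < k.+1) y i).
Proof.
elim: k => [|k IH] ym.
  by rewrite !big_geq// addr0 subrr; split; exact: vge0.
have yk : vge m (y k.+1) by apply: ym; lia.
have [] := IH; first by move=> i ik; apply: ym; lia.
rewrite !(big_nat_recr k.+1)//=.
set p := \prod_(_ <= _ < _) _; set s := \sum_(_ <= _ < _) _ => v1 v2.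
split.
  have -> : p * (1 - y k.+1) - 1 = (p - 1) - (p - 1) * y k.+1 - y k.+1 by ring.
  do 2 apply: vgeB => //; apply: (vge_le (m%:Z + m%:Z)); first by lia.
  exact: vgeM.
have -> : p * (1 - y k.+1) - 1 + (s + y k.+1) = (p - 1 + s) - (p - 1) * y k.+1.
  by ring.
by apply: vgeB => //; rewrite PoszD; exact: vgeM.
Qed.

Lemma vge_natr_div (f k i : nat) :
  (i <= k)%N -> vge (f%:Z - (trunc_log 3 k)%:Z) ((3 ^ f)%:R / i%:R).
Proof.
move=> ik; apply: vgeM; last exact: vge_inv_trunc_log.
by rewrite natrX; exact: (vge_exp3 f).
Qed.

(** Subtracting [sum_geomX_prod] at 3m = 3^f from the integral of [geomX] multiplies each term by 1
    minus a product, which is small since 3^f / i is. *)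
Lemma vge_sum_invcb (f : nat) :
  (0 < f)%N -> vge (f%:Z - 2) (\sum_(0 <= k < 3 ^ f) invcb k).
Proof.
case: f => // f _; apply: vge_half.
have p0 := expn_gt0 3 f; rewrite /= in p0.
have qM : (3 * 3 ^ f <= (3 * 3 ^ f).*2)%N by lia.
have := sum_geomX_prod _ Q3_pchar _ _ p0 qM; rewrite -expnS => prod0.
rewrite -(sum_coef_geomX _ Q3_pchar _ _ (leqnn _)) -[X in vge _ X]subr0.
rewrite -[X in vge _ (_ - X)]prod0.
rewrite -sumrB; apply: vge_sum_nat => j _.
have -> (a p : Q3) : a - a * p = - (a * (p - 1)) by ring.
apply: vgeN; apply: (vge_le (((uphalf j)%:Z + - (trunc_log 3 j.+1)%:Z)
    + (f.+1%:Z - (trunc_log 3 j)%:Z))).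
  by have := muln4_trunc_log j; have := trunc_log3S j; have := uphalfE j; lia.
apply: vgeM; first by apply: vgeM; [exact: vge_coef_geomX|exact: vge_inv].
have [jf|fj] := leqP (trunc_log 3 j) f.+1.
  have -> : f.+1%:Z - (trunc_log 3 j)%:Z = (f.+1 - trunc_log 3 j)%N by lia.
  have [] // := vge_prod_one_sub (f.+1 - trunc_log 3 j) j
    (fun i => (3 ^ f.+1)%:R / i%:R).
  move=> i /andP[_ ij]; rewrite -subzn//; exact: vge_natr_div.
(* For such j the product contains the zero factor at i = 3^(f+1), while the exponent to reach, f +
   1 - log j, is negative. *)
have jq : (3 ^ f.+1 <= j)%N.
  have j0 : (0 < j)%N by move: fj; case: (j) => //; rewrite trunc_log0.
  apply: leq_trans (trunc_logP (isT : (1 < 3)%N) j0).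
  by rewrite leq_exp2l//; exact: ltnW.
have -> : \prod_(1 <= i < j.+1) (1 - (3 ^ f.+1)%:R / i%:R) = 0 :> Q3.
  have := expn_gt0 3 f.+1; move: jq; case: (3 ^ f.+1)%N => // n nj _.
  by rewrite (prod_one_sub_div _ Q3_pchar) bin_small// mulr0.
by rewrite sub0r; apply: vgeN; apply: vge_le (vge_nat 1); lia.
Qed.

(** The bound at 2f transfers down, because the terms with k >= 3^f are already divisible by
    3^(2f-2). The doubling pays for a later division by q. *)
Lemma vge_sum_invcb_sharp (f : nat) :
  (0 < f)%N -> vge ((2 * f)%N%:Z - 2) (\sum_(0 <= k < 3 ^ f) invcb k).
Proof.
move=> f0; have := vge_sum_invcb (2 * f); rewrite muln_gt0 f0 => /(_ isT) h.
have qQ : (3 ^ f <= 3 ^ (2 * f))%N by rewrite leq_exp2l//; lia.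
rewrite (big_cat_nat _ qQ)//= in h.
have -> : \sum_(0 <= k < 3 ^ f) invcb k =
  (\sum_(0 <= k < 3 ^ f) invcb k + \sum_(3 ^ f <= k < 3 ^ (2 * f)) invcb k)
  - \sum_(3 ^ f <= k < 3 ^ (2 * f)) invcb k :> Q3 by rewrite addrK.
apply: vgeB => //; apply: vge_sum_nat => k /andP[qk _].
apply: vge_le (vge_invcb k).
have := muln3_trunc_log k; have : (f <= trunc_log 3 k)%N by rewrite trunc_log_max.
lia.
Qed.

(** * Harmonic numbers and convergence to beta *)

Lemma harmonic_num0 : harmonic_num 0 = 0.
Proof. by rewrite /harmonic_num big_geq. Qed.

Lemma harmonic_numS n : harmonic_num n.+1 = harmonic_num n + n.+1%:R^-1.
Proof. by rewrite /harmonic_num big_nat_recr. Qed.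

Lemma vge_harmonic_num n : vge (- (trunc_log 3 n)%:Z) (harmonic_num n).
Proof. by apply: vge_sum_nat => i /andP[_ ik]; exact: vge_inv_trunc_log. Qed.

Lemma beta_termS k : beta_term k.+1 = invcb k * harmonic_num k.
Proof. by rewrite /beta_term /invcb invfM mulrA. Qed.

Lemma vge_beta_termS k :
  vge (k%:Z - (2 * trunc_log 3 k)%N%:Z - 1) (beta_term k.+1).
Proof.
rewrite beta_termS; apply: vge_le (vgeM _ _ _ _ (vge_invcb k) (vge_harmonic_num k)).
lia.
Qed.

Lemma beta_partialS n :
  beta_partial n.+1 = \sum_(0 <= k < n) beta_term k.+1.
Proof.
case: n => [|n]; first by rewrite /beta_partial !big_geq.
(* The extra term at index 1 is zero because H_0 = 0. *)
rewrite /beta_partial big_add1 /= [RHS]big_ltn// [beta_term 1]beta_termS.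
by rewrite harmonic_num0 mulr0 add0r.
Qed.

Lemma beta_limit : exists b : Z3,
  [/\ cvgn beta_partial, beta = tofrac b &
      forall (m N : nat), (forall k, (N <= k)%N -> vge m (beta_term k.+1)) ->
        vge m (tofrac b - \sum_(0 <= k < N) beta_term k.+1)].
Proof.
have t0 k : vge 0 (beta_term k.+1).
  (* At k = 0 the general bound is only -1, but H_0 = 0. *)
  have [->|k0] := posnP k.
    by rewrite beta_termS harmonic_num0 mulr0; exact: vge0.
  by apply: vge_le (vge_beta_termS k); have := muln3_trunc_log k; lia.
have tm (m : nat) : exists N, forall k, (N <= k)%N -> vge m (beta_term k.+1).
  (* From there on k - 2 log k - 1 >= log k - 1 >= m. *)
  exists (3 ^ m.+1)%N => k mk; apply: vge_le (vge_beta_termS k).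
  have : (m.+1 <= trunc_log 3 k)%N by rewrite trunc_log_max.
  by have := muln3_trunc_log k; lia.
have [b bP] := congr3_series_limit _ t0 tm; exists b.
have cb : beta_partial @ \oo --> (tofrac b : Q3).
  move=> A [m _ mA]; have [N NP] := tm m; exists N.+1 => // -[//|n] /= Nn.
  apply: mA; have /vgeN : vge m (tofrac b - \sum_(0 <= k < n) beta_term k.+1).
    by apply: bP => k nk; apply: NP; lia.
  by rewrite opprB -beta_partialS.
split=> //; first by apply/cvg_ex; exists (tofrac b).
exact: (cvg_lim Q3_hausdorff cb).
Qed.

(** * The congruence modulo 3^(f-2) *)

(** Splits p_k as (p_k - 1 + q h_k) + 1 - q h_k: a quadratic remainder, a constant part, and a
    linear part to be compared with b. *)
Lemma sum_first_order_split (F : fieldType) (n : nat) (q c b : F)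
    (w p h : nat -> F) : q != 0 ->
  (q ^+ 2)^-1 * (q * c * \sum_(0 <= k < n) w k * p k) - - b * c =
  c * (\sum_(0 <= k < n) w k * (p k - 1 + q * h k) * q^-1
       + q^-1 * (\sum_(0 <= k < n) w k)
       + (b - \sum_(0 <= k < n) w k * h k)).
Proof.
move=> q0.
have -> : \sum_(0 <= k < n) w k * (p k - 1 + q * h k) * q^-1 =
    q^-1 * (\sum_(0 <= k < n) w k * p k) - q^-1 * (\sum_(0 <= k < n) w k)
    + \sum_(0 <= k < n) w k * h k.
  by rewrite !mulr_sumr -sumrB -big_split /=; apply: eq_bigr => k _; field.
by field.
Qed.

(** Each of the three parts of the split reaches f - 2: the remainder gives f + k - 3 log k - 1, the
    constant part (2f - 2) - f, and the linear part is the hypothesis. *)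
Lemma congr3_sum_central_bin (f : nat) (b : Z3) :
  (0 < f)%N ->
  vge (f%:Z - 2) (tofrac b - \sum_(0 <= k < 3 ^ f) beta_term k.+1) ->
  vge (f%:Z - 2) (((3 ^ f)%:R ^+ 2)^-1 * (\sum_(0 <= k < 3 ^ f) 'C(k.*2, k)%:R)
    - - tofrac b * 'C((3 ^ f).*2, 3 ^ f)%:R).
Proof.
move=> f0 hb; rewrite (sum_central_bin _ Q3_pchar).
have vq : vge (- f%:Z) (3 ^ f)%:R^-1.
  by rewrite natrX exprnP invr_expz; exact: vge_exp3.
have := vge_sum_invcb_sharp f f0.
have vprod k : (k < 3 ^ f)%N -> vge (2 * (f - trunc_log 3 k))%N
  (\prod_(1 <= i < k.+1) (1 - (3 ^ f)%:R / i%:R) - 1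
   + (3 ^ f)%:R * harmonic_num k).
  move=> kq; have lf : (trunc_log 3 k <= f)%N.
    by rewrite -[leqRHS](@trunc_expnK 3)//; apply: leq_trunc_log; exact: ltnW.
  have [|_] := vge_prod_one_sub (f - trunc_log 3 k) k
      (fun i => (3 ^ f)%:R / i%:R).
    by move=> i /andP[_ ik]; rewrite -subzn//; apply: vge_natr_div.
  by rewrite addnn -mul2n -mulr_sumr.
have qnz : (3 ^ f)%:R != 0 :> Q3 by rewrite Q3_natr_eq0 expn_eq0.
move: vprod vq hb qnz; set q := (3 ^ f)%N; clearbody q => vprod vq hb qnz hA.
rewrite (sum_first_order_split _ _ _ _ _ _ _ harmonic_num)//.
rewrite -(eq_bigr _ (fun k _ => beta_termS k)).
rewrite -[f%:Z - 2]add0r; apply: vgeM; first exact: vge_nat.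
apply: vgeD => //; apply: vgeD.
  apply: vge_sum_nat => k /andP[_ kq].
  apply: vge_le (vgeM _ _ _ _ (vgeM _ _ _ _ (vge_invcb k) (vprod k kq)) vq).
  by have := muln3_trunc_log k; lia.
by apply: vge_le (vgeM _ _ _ _ vq hA); lia.
Qed.

(** For e <= 0 the right side is at most 4/3; for e = 1 it is 5, whereas e < f forces 2f + 2 >= 6.
    The conclusion yields f - 2e + 2 <= f - 2. *)
Lemma two_le_exponent (f : nat) (e : int) :
  (0 < f)%N -> e < f%:Z ->
  2 * f%:R + 2 <= 4 * 3 ^ (e - 1) + e%:~R :> rat -> 2 <= e.
Proof.
move=> f0 ef h; rewrite leNgt; apply/negP => e2.
move: h; apply/negP; rewrite -ltNge.
have [e1|e0] : e = 1 \/ e <= 0 by lia.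
  rewrite e1 subrr expr0z mulr1.
  have f2 : 2 <= f%:R :> rat by rewrite ler_nat; lia.
  have -> : 1%:~R = 1 :> rat by [].
  by lra.
have f1 : 1 <= f%:R :> rat by rewrite ler1n.
have e0' : e%:~R <= 0 :> rat by rewrite lerz0.
have : 3 ^ (e - 1) <= 3 ^ (-1) :> rat by rewrite ler_weXz2l//; lia.
by rewrite exprN1; lra.
Qed.

(** * The first digits of beta *)

(* [(a, b, c, D, E)] stands for [invcb k = a / D], [harmonic_num k = b / E] and
   the partial sum [c / (D * E)] of beta; [Z] is used because [int] is unary. *)
Definition beta_step (k : nat) (s : Z * Z * Z * Z * Z) : Z * Z * Z * Z * Z :=
  let '(a, b, c, D, E) := s in
  (a * (3 * k.+1%:R), b * k.+1%:R + E,
   (c + a * b) * (2 * k.*2.+3%:R * k.+1%:R), D * (2 * k.*2.+3%:R), E * k.+1%:R).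

Definition beta_state (n : nat) := iteri n beta_step (1, 0, 0, 2, 1).

Lemma beta_state_step (F : fieldType) (a b c d e k1 k3 : F) :
  2 != 0 :> F -> k1 != 0 -> k3 != 0 -> d != 0 -> e != 0 ->
  [/\ d * (2 * k3) != 0, e * k1 != 0,
      a / d * (3 * k1 / (2 * k3)) = a * (3 * k1) / (d * (2 * k3)),
      b / e + k1^-1 = (b * k1 + e) / (e * k1) &
      c / (d * e) + a / d * (b / e) =
      (c + a * b) * (2 * k3 * k1) / (d * (2 * k3) * (e * k1))].
Proof.
by move=> n2 n1 n3 d0 e0; rewrite !mulf_neq0//; split=> //; field;
  rewrite ?n2 ?n1 ?n3 ?d0 ?e0.
Qed.

Lemma beta_stateP (phi : {rmorphism Z -> Q3}) n :
  let '(a, b, c, D, E) := beta_state n in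
  [/\ phi D != 0, phi E != 0, invcb n = phi a / phi D,
      harmonic_num n = phi b / phi E &
      \sum_(0 <= k < n) beta_term k.+1 = phi c / (phi D * phi E)].
Proof.
have nz i : i.+1%:R != 0 :> Q3 by rewrite Q3_natr_eq0.
elim: n => [|n].
  rewrite /= !(rmorph0, rmorph1, rmorph_nat) !mul0r harmonic_num0.
  rewrite big_geq//; split; rewrite ?oner_neq0 ?(nz 1%N)//.
  have c1 : 'C(1.*2, 1) = 2%N by [].
  by rewrite /invcb c1 expr0 !mul1r.
have sumS : \sum_(0 <= k < n.+1) beta_term k.+1 =
    \sum_(0 <= k < n) beta_term k.+1 + invcb n * harmonic_num n.
  by rewrite -beta_termS big_nat_recr.
rewrite /beta_state iteriS -/(beta_state n) /beta_step.
case: (beta_state n) => [[[[a b] c] D] E].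
move=> [D0 E0 wE hE sE]; rewrite !(rmorph_nat, rmorphM, rmorphD).
rewrite (invcbS _ Q3_pchar) harmonic_numS sumS sE wE hE.
exact: (beta_state_step _ _ _ _ _ _ _ _ (nz 1%N) (nz n) (nz n.*2.+2) D0 E0).
Qed.

Lemma vge_int (m : int) : vge 0 m%:~R.
Proof. by exists m%:~R; rewrite expr0z mul1r; apply/esym/rmorph_int. Qed.

Lemma vge_inv_Z (phi : {rmorphism Z -> Q3}) (d : Z) :
  Z.modulo d 3 != 0 -> vge 0 (phi d)^-1.
Proof.
move=> d3; have phiE n : phi (Z_of_int n%:Z) = n%:R by rewrite -natz !rmorph_nat.
have n3 (n : nat) : d = Z_of_int n%:Z \/ d = - Z_of_int n%:Z -> coprime n 3.
  move=> dn; rewrite coprime_sym prime_coprime//; apply: contra d3 => /dvdnP[m nE].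
  have {nE} nE : Z_of_int n%:Z = Z_of_int m%:Z * 3.
    by rewrite nE PoszM rmorphM -[3%:Z]natz rmorph_nat.
  by case: dn => ->; rewrite nE -?mulNr; apply/eqP; exact: Z_mod_mult.
have := int_of_ZK d; case: (intP (int_of_Z d)) => [|n|n] dE.
- by rewrite -dE !rmorph0 invr0; exact: vge0.
- by rewrite -dE phiE; apply: vge_inv_coprime; apply: n3; left.
rewrite -dE !rmorphN phiE invrN; apply: vgeN; apply: vge_inv_coprime.
by apply: n3; right; rewrite -dE rmorphN addn1.
Qed.

(** Polymorphic, to be computed in [Z] and then mapped into [Q3]. *)
Definition beta_digits (R : pzSemiRingType) : R :=
  1 + 3 + 2 * 3 ^+ 3 + 2 * 3 ^+ 4 + 2 * 3 ^+ 5 + 3 ^+ 7 + 2 * 3 ^+ 11.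

(** A division-free form of c / (D E) = g modulo 3^m, with v the exact power of 3 in the
    denominator. *)
Definition beta_state_congr (n m v : nat) (g : Z) : Prop :=
  let '(a, b, c, D, E) := beta_state n in
  exists d w : Z, [/\ D * E = 3 ^+ v * d,
    c - g * (D * E) = 3 ^+ (m + v) * w & Z.modulo d 3 != 0].

Lemma vge_beta_sum (phi : {rmorphism Z -> Q3}) (n m v : nat) (g : Z) :
  (forall z, vge 0 (phi z)) -> beta_state_congr n m v g ->
  vge m (\sum_(0 <= k < n) beta_term k.+1 - phi g).
Proof.
rewrite /beta_state_congr => phi0; have := beta_stateP phi n.
case: (beta_state n) => [[[[a b] c] D] E] [D0 E0 _ _ ->] [d [w [DE cE d3]]].
have DE0 : phi (D * E) != 0 by rewrite rmorphM; exact: mulf_neq0 D0 E0.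
rewrite -rmorphM -[X in _ - X](mulfK DE0) -mulrBl -rmorphM -rmorphB cE DE.
rewrite !(rmorphM, rmorphXn, rmorph_nat) exprD -mulf_div.
rewrite mulfK ?expf_neq0 ?Q3_three_neq0//.
apply: (vge_le (m%:Z + (0 + 0))); first by rewrite !addr0.
apply: vgeM; first exact: (vge_exp3 m).
by apply: vgeM => //; exact: vge_inv_Z.
Qed.

Lemma beta_state_congr28 : beta_state_congr 28 12 27 (beta_digits Z).
Proof.
(* The exponent 27 is the valuation of D E after 28 steps, and 12 covers digits up to 3^11; both
   witnesses are quotients checked by computation. *)
pose test (s : Z * Z * Z * Z * Z) := let '(a, b, c, D, E) := s in
  let d := Z.div (D * E) (3 ^+ 27) in
  let w := Z.div (c - beta_digits Z * (D * E)) (3 ^+ (12 + 27)) in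
  [&& D * E == 3 ^+ 27 * d, c - beta_digits Z * (D * E) == 3 ^+ (12 + 27) * w &
      Z.modulo d 3 != 0].
have : test (beta_state 28) by vm_compute.
rewrite /beta_state_congr; move: (beta_state 28) => [[[[a b] c] D] E].
move=> /and3P[/eqP h1 /eqP h2 h3].
by eexists; eexists; split; [exact: h1|exact: h2|].
Qed.

Lemma vge_beta_sum28 :
  vge 12%N (\sum_(0 <= k < 28) beta_term k.+1 - beta_digits Q3).
Proof.
pose phi : {rmorphism Z -> Q3} := intr \o int_of_Z.
have -> : beta_digits Q3 = phi (beta_digits Z).
  by rewrite /beta_digits !(rmorphD, rmorphM, rmorphXn, rmorph_nat, rmorph1).
by apply: vge_beta_sum beta_state_congr28 => z; exact: vge_int.
Qed.

Theorem theorem1 :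
  [/\ cvgn beta_partial,
      exists b : Z3, beta = tofrac b,
      congr3 12 beta
        (1 + 3 + 2 * 3 ^+ 3 + 2 * 3 ^+ 4 + 2 * 3 ^+ 5 + 3 ^+ 7 + 2 * 3 ^+ 11)
    & forall (f : nat) (e : int),
        (0 < f)%N -> e < f%:Z ->
        2 * f%:R + 2 <= 4 * 3 ^ (e - 1) + e%:~R :> rat ->
        let q := (3 ^ f)%N in
        congr3 (f%:Z - 2 * e + 2)
          ((q%:R ^+ 2)^-1 * \sum_(0 <= k < q) 'C(k.*2, k)%:R)
          (- beta * 'C(q.*2, q)%:R)].
Proof.
have [b [cvg_beta betaE tail]] := beta_limit; split=> //; first by exists b.
  have tail28 : vge 12%N (beta - \sum_(0 <= k < 28) beta_term k.+1).
    rewrite betaE; apply: tail => k k28; apply: vge_le (vge_beta_termS k).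
    (* 28 terms suffice: k - 2 log k - 1 >= k/2 - 2 >= 12. *)
    by have := muln4_trunc_log k; lia.
  apply: congr3_trans vge_beta_sum28; exact: tail28.
move=> f e f0 ef cond q; have e2 := two_le_exponent f e f0 ef cond.
apply: (vge_le (f%:Z - 2)); first by lia.
rewrite betaE; apply: congr3_sum_central_bin => //.
(* The natural subtraction is exact since 2 <= e < f. *)
have -> : f%:Z - 2 = (f - 2)%N by lia.
apply: tail => k qk; apply: vge_le (vge_beta_termS k).
have : (f <= trunc_log 3 k)%N by rewrite trunc_log_max.
by have := muln3_trunc_log k; lia.
Qed.
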